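(* There is a satisfiable HyperLTL sentence that is not satisfied by any set of traces that contains an ultimately periodic trace.
   Context: Fix a finite set $AP$ of atomic propositions. A trace over $AP$ is a map $t:\mathbb{N}\to 2^{AP}$. A trace $t$ is ultimately periodic if $t=t_0\cdot t_1^\omega$ for some nonempty finite words $t_0,t_1$ over $2^{AP}$, i.e., there are $s,p>0$ with $t(n)=t(n+p)$ for all $n\ge s$. HyperLTL formulas are given by the grammar $\varphi ::= \exists \pi.\ \varphi \mid \forall \pi.\ \varphi \mid \psi$ and $\psi ::= a_\pi \mid \neg\psi \mid \psi\vee\psi \mid \mathbf{X}\psi \mid \psi\,\mathbf{U}\,\psi$, where $a\in AP$ and $\pi$ ranges over a countable set of trace variables. For a set $T$ of traces and a trace assignment $\Pi$ (a partial map from trace variables to traces), with $\Pi[j]$ denoting the assignment mapping each $\pi$ in the domain of $\Pi$ to the suffix $\Pi(\pi)(j)\Pi(\pi)(j+1)\cdots$: $(T,\Pi)\models a_\pi$ iff $a\in\Pi(\pi)(0)$; negation and disjunction are as usual; $(T,\Pi)\models\mathbf{X}\psi$ iff $(T,\Pi[1])\models\psi$; $(T,\Pi)\models\psi_1\mathbf{U}\psi_2$ iff there is $j\ge 0$ with $(T,\Pi[j])\models\psi_2$ and $(T,\Pi[j'])\models\psi_1$ for all $0\le j'<j$; $(T,\Pi)\models\exists\pi.\varphi$ iff there is $t\in T$ with $(T,\Pi[\pi\mapsto t])\models\varphi$; $(T,\Pi)\models\forall\pi.\varphi$ iff this holds for all $t\in T$. A sentence is a formula without free trace variables; $T$ satisfies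 (is a model of) a sentence $\varphi$ if $(T,\Pi_\emptyset)\models\varphi$ for the empty assignment $\Pi_\emptyset$. A sentence is satisfiable if it has a model. *)

(* Defs.v *)
From HB Require Import structures.
From mathcomp Require Import all_boot.
From mathcomp Require Import boolp classical_sets.

Set Implicit Arguments.
Unset Strict Implicit.
Unset Printing Implicit Defensive.

Local Open Scope classical_set_scope.

Definition trace (AP : finType) : Type := nat -> {set AP}.

Definition suffix (AP : finType) (t : trace AP) (j : nat) : trace AP :=
  fun n => t (j + n)%N.

(* The infinite word t0 . t1^omega; only meaningful for nonempty t1. *)
Definition lasso (AP : finType) (t0 t1 : seq {set AP}) : trace AP :=
  fun n => if (n < size t0)%N then nth finset.set0 t0 n
           else nth finset.set0 t1 ((n - size t0) %% size t1).

Definition ultimately_periodic (AP : finType) (t : trace AP) : Prop :=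
  exists t0 t1 : seq {set AP},
    [/\ t0 <> [::], t1 <> [::] & forall n, t n = lasso t0 t1 n].

Lemma ultimately_periodicP (AP : finType) (t : trace AP) :
  ultimately_periodic t <->
  exists s p : nat,
    [/\ (0 < s)%N, (0 < p)%N & forall n, (s <= n)%N -> t n = t (n + p)%N].
Proof.
split=> [[t0 [t1 [t0N t1N tE]]]|[s [p [s_gt0 p_gt0 tP]]]].
  exists (size t0), (size t1); split.
  - by case: t0 t0N {tE}.
  - by case: t1 t1N {tE}.
  move=> n le_n; rewrite !tE /lasso !ltnNge le_n (leq_trans le_n) ?leq_addr //=.
  by rewrite -addnBAC // modnDr.
exists (mkseq t s), (mkseq (fun i => t (s + i)%N) p); split.
- by move/(congr1 size); rewrite size_mkseq; case: s s_gt0 {tP}.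
- by move/(congr1 size); rewrite size_mkseq; case: p p_gt0 {tP}.
move=> n; rewrite /lasso !size_mkseq; case: ltnP => [lt_ns|le_sn].
  by rewrite nth_mkseq.
rewrite nth_mkseq ?ltn_mod // -{1}(subnKC le_sn) {1}(divn_eq (n - s) p).
elim: (_ %/ _) => [|k IHk]; first by rewrite mul0n.
rewrite -IHk mulSn -addnA [(p + _)%N]addnC addnA -tP ?leq_addr //.
Qed.

Definition tvar : Type := nat.

Inductive ltl (AP : finType) : Type :=
| Atom of AP & tvar
| Neg of ltl AP
| Or of ltl AP & ltl AP
| Next of ltl AP
| Until of ltl AP & ltl AP.

Inductive hyperltl (AP : finType) : Type :=
| Exists of tvar & hyperltl AP
| Forall of tvar & hyperltl AP
| Matrix of ltl AP.

Fixpoint ltl_vars (AP : finType) (psi : ltl AP) : seq tvar :=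
  match psi with
  | Atom _ x => [:: x]
  | Neg p => ltl_vars p
  | Or p q => ltl_vars p ++ ltl_vars q
  | Next p => ltl_vars p
  | Until p q => ltl_vars p ++ ltl_vars q
  end.

Fixpoint free_vars (AP : finType) (phi : hyperltl AP) : seq tvar :=
  match phi with
  | Exists x f => [seq y <- free_vars f | y != x]
  | Forall x f => [seq y <- free_vars f | y != x]
  | Matrix p => ltl_vars p
  end.

Definition sentence (AP : finType) (phi : hyperltl AP) : Prop :=
  free_vars phi = [::].

Definition assignment (AP : finType) : Type := tvar -> option (trace AP).

Definition empty_assignment (AP : finType) : assignment AP := fun _ => None.

Definition update (AP : finType) (Pi : assignment AP) (x : tvar)
    (t : trace AP) : assignment AP :=
  fun y => if y == x then Some t else Pi y.

Definition shift (AP : finType) (Pi : assignment AP) (j : nat) :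
    assignment AP :=
  fun x => omap (fun t => suffix t j) (Pi x).

(* The satisfaction relation (T, Pi) |= psi does not depend on T for
   quantifier-free psi. An atom at a variable outside the domain of Pi is
   false; this never arises when evaluating a sentence from the empty
   assignment. *)
Fixpoint ltl_sat (AP : finType) (Pi : assignment AP) (psi : ltl AP) : Prop :=
  match psi with
  | Atom a x => exists2 t, Pi x = Some t & a \in t 0%N
  | Neg p => ~ ltl_sat Pi p
  | Or p q => ltl_sat Pi p \/ ltl_sat Pi q
  | Next p => ltl_sat (shift Pi 1) p
  | Until p q => exists2 j : nat, ltl_sat (shift Pi j) q &
      forall j' : nat, (j' < j)%N -> ltl_sat (shift Pi j') p
  end.

Fixpoint sat (AP : finType) (T : set (trace AP)) (Pi : assignment AP)
    (phi : hyperltl AP) : Prop :=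
  match phi with
  | Exists x f => exists2 t, T t & sat T (update Pi x t) f
  | Forall x f => forall t, T t -> sat T (update Pi x t) f
  | Matrix p => ltl_sat Pi p
  end.

Definition models (AP : finType) (T : set (trace AP)) (phi : hyperltl AP) :
    Prop :=
  sat T (@empty_assignment AP) phi.

(* The witnessing model is required to be nonempty: the empty set of traces
   satisfies every sentence starting with a universal quantifier, even
   "forall x. false". *)
Definition satisfiable (AP : finType) (phi : hyperltl AP) : Prop :=
  exists2 T : set (trace AP), T !=set0 & models T phi.

(* Main.v *)
Require Import Defs.
From HB Require Import structures.
From mathcomp Require Import all_boot.
From mathcomp Require Import boolp classical_sets.
From mathcomp Require Import zify.

(** Fix an atom [a] and read a trace as the set of positions carrying [a].
The sentence says that every such set [x] is infinite and has a refinement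
[y] in the model: from some position on, [x] is contained in [y] and [y] has
a point strictly between any two consecutive points of [x]. Refining lowers
the eventual maximal gap length, so by infinite descent no set in a model has
eventually bounded gaps, whereas an infinite ultimately periodic set does.
A model is formed by the sets of binary floating-point numbers, one for each
mantissa length: one more bit of mantissa inserts all the midpoints. *)

(** * Refinement and gap lengths *)

Definition infinitely_often (x : pred nat) : Prop :=
  forall N, exists2 n, N <= n & x n.

(** The next point of [x] is never named: [j] precedes it because [x] has no point in []n, j]], a
    condition that [Until] can express. *)
Definition refined_at (x y : pred nat) (n : nat) : Prop :=
  x n -> y n /\ exists2 j, n < j &
    [/\ y j, ~~ x j & forall i, n < i < j -> ~~ x i].

Definition eventually_refined (x y : pred nat) : Prop :=
  exists N, forall n, N <= n -> refined_at x y n.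

(** Windows of length [g] replace distances between points, so that the bound [0] is contradictory
    and can end the descent. *)
Definition gaps_bounded (g : nat) (x : pred nat) : Prop :=
  exists N, forall n, N <= n -> exists2 i, i < g & x (n + i).

(** A point of [x] in a window of length [g] also lies in [y]. If there is none, the two windows of
    length [g.+1] extending it force points of [x] at both adjacent positions, and the point of [y]
    inserted between them falls into the window. *)
Lemma gaps_bounded_refined {g : nat} {x y : pred nat} :
  eventually_refined x y -> gaps_bounded g.+1 x -> gaps_bounded g y.
Proof.
move=> [N xyP] [M xP]; exists (N + M).+1 => -[//|n] le_n.
have [|i] := xP n.+1; first by lia.
rewrite ltnS leq_eqVlt => /predU1P[->|lt_ig] xi; last first.
  by exists i => //; case: (xyP (n.+1 + i) _ xi); first lia.
(* The only point of [x] in the window [n+1 .. n+1+g] may be its last one;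
   then the window starting at [n] provides another one or [n] itself. *)
have [|k lt_kg xk] := xP n; first by lia.
case: k lt_kg xk => [_|k lt_kg] xk; last first.
  rewrite addnS -addSn in xk; exists k => //.
  by case: (xyP (n.+1 + k) _ xk); first lia.
rewrite addn0 in xk; have [|_ [j lt_nj [yj xj no_x]]] := xyP n _ xk; first lia.
have [le_j|lt_j] := leqP j (n.+1 + g).
  exists (j - n.+1); last by rewrite subnKC.
  suff: j != n.+1 + g by lia.
  by apply: contraNneq xj => ->.
by move: (no_x (n.+1 + g)); rewrite xi lt_j andbT => /(_ ltac:(lia)).
Qed.

(** Any point beyond [n] can be moved back by whole periods into the window of length [p] at [n]. *)
Lemma gaps_bounded_periodic {s p : nat} {x : pred nat} :
  0 < p -> (forall n, s <= n -> x n = x (n + p)) -> infinitely_often x ->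
  gaps_bounded p x.
Proof.
move=> p_gt0 xp x_inf; exists s => n le_sn; have [m le_nm xm] := x_inf n.
exists ((m - n) %% p); first by rewrite ltn_mod.
move: xm; rewrite -{1}(subnKC le_nm) {1}(divn_eq (m - n) p).
elim: (_ %/ _) => // q IHq; rewrite mulSn => xm; apply: IHq.
by rewrite xp; [move: xm; congr (is_true (x _)); lia | lia].
Qed.

(** * Floating-point numbers *)

Definition float (k : nat) : pred nat :=
  fun n => `[< exists u m, u < 2 ^ k /\ n = u * 2 ^ m >].

Lemma float_infinite (k : nat) : infinitely_often (float k.+1).
Proof.
move=> N; exists (2 ^ N); first exact/ltnW/ltn_expl.
by apply/asboolP; exists 1, N; rewrite mul1n -{1}(expn0 2) ltn_exp2l.
Qed.

(** Double the mantissa and lower the exponent until the top bit is set; at exponent [0] the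
    mantissa is [n] itself, which is large enough. *)
Lemma float_normal {k n : nat} : 2 ^ k <= n -> float k.+1 n ->
  exists u m, 2 ^ k <= u < 2 ^ k.+1 /\ n = u * 2 ^ m.
Proof.
move=> le_kn /asboolP[u [m [lt_u nE]]].
elim: m u lt_u nE => [|m IHm] u lt_u nE.
  by exists u, 0; rewrite lt_u andbT; move: le_kn; rewrite nE muln1.
have [le_u|lt_uk] := leqP (2 ^ k) u; first by exists u, m.+1; rewrite le_u.
apply: (IHm u.*2); first by rewrite expnS; lia.
by rewrite nE expnS; lia.
Qed.

(** A float with exponent at least [m] is a multiple of [2 ^ m], and one with a smaller exponent is
    below [2 ^ (k + m)]. *)
Lemma float_gap {k u m i : nat} : 2 ^ k <= u ->
  u * 2 ^ m < i < u.+1 * 2 ^ m -> ~~ float k.+1 i.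
Proof.
move=> le_ku /andP[lt_ui lt_iu]; apply/negP => /asboolP[v [l [lt_v iE]]].
have [le_ml|lt_lm] := leqP m l.
  move: lt_ui lt_iu; rewrite iE -(subnK le_ml) expnD mulnA.
  by rewrite !ltn_pmul2r ?expn_gt0 // ltnS ltnNge => /negbTE ->.
suff: v * 2 ^ l < u * 2 ^ m by lia.
apply: (@leq_trans (2 ^ k.+1 * 2 ^ l)).
  by rewrite ltn_pmul2r ?expn_gt0.
rewrite -expnD addSnnS expnD leq_mul // leq_exp2l //.
Qed.

Lemma float_refined (k : nat) : eventually_refined (float k.+1) (float k.+2).
Proof.
(* Beyond this threshold the normalized exponent is positive, so the midpoint to the next float is
   an integer. *)
exists (2 ^ k.+1) => n le_n xn; split.
  move/asboolP: xn => [u [m [lt_u nE]]]; apply/asboolP; exists u, m; split=> //.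
  by rewrite expnS; lia.
have [|u [m [/andP[le_u lt_u] nE]]] := float_normal _ xn.
  by move: le_n; rewrite expnS; lia.
case: m nE => [|m] nE; first by move: le_n; rewrite nE muln1; lia.
have m_gt0 : 0 < 2 ^ m by rewrite expn_gt0.
have nE' : n = u.*2 * 2 ^ m by rewrite nE expnS; lia.
exists (u.*2.+1 * 2 ^ m); first by rewrite nE' ltn_pmul2r.
have le_mid : u.*2.+1 * 2 ^ m < u.+1 * 2 ^ m.+1.
  by rewrite expnS mulnA ltn_pmul2r //; lia.
have lt_mid : u * 2 ^ m.+1 < u.*2.+1 * 2 ^ m by rewrite -nE nE' ltn_pmul2r.
split.
- by apply/asboolP; exists u.*2.+1, m; split=> //; rewrite expnS; lia.
- by apply: (float_gap le_u (m := m.+1)); rewrite lt_mid.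
- move=> i /andP[lt_ni lt_i]; apply: (float_gap le_u (m := m.+1)).
  by rewrite -nE lt_ni (ltn_trans lt_i).
Qed.

(** * The sentence and its models *)

Section Formula.

Context {AP : finType}.
Implicit Types (Pi : assignment AP) (p q : ltl AP).

Definition And p q := Neg (Or (Neg p) (Neg q)).
Definition Eventually p := Until (Or p (Neg p)) p.
Definition Always p := Neg (Eventually (Neg p)).

Lemma shift_shift Pi i j : shift (shift Pi i) j = shift Pi (i + j).
Proof.
apply/funext => v; rewrite /shift; case: (Pi v) => //= t; congr Some.
by apply/funext => n; rewrite /Defs.suffix addnA.
Qed.

Lemma Neg_sat Pi p : ltl_sat Pi (Neg p) <-> ~ ltl_sat Pi p.
Proof. by []. Qed.

Lemma Or_sat Pi p q : ltl_sat Pi (Or p q) <-> ltl_sat Pi p \/ ltl_sat Pi q.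
Proof. by []. Qed.

Lemma Next_sat Pi p : ltl_sat Pi (Next p) <-> ltl_sat (shift Pi 1) p.
Proof. by []. Qed.

Lemma Until_sat Pi p q :
  ltl_sat Pi (Until p q) <->
  exists2 j, ltl_sat (shift Pi j) q &
    forall i, i < j -> ltl_sat (shift Pi i) p.
Proof. by []. Qed.

Lemma And_sat Pi p q :
  ltl_sat Pi (And p q) <-> ltl_sat Pi p /\ ltl_sat Pi q.
Proof. by rewrite /= -not_andE notK. Qed.

Lemma Eventually_sat Pi p :
  ltl_sat Pi (Eventually p) <-> exists j, ltl_sat (shift Pi j) p.
Proof.
split=> [[j pj _]|[j pj]]; first by exists j.
by exists j => // i _; exact: EM.
Qed.

Lemma Always_sat Pi p :
  ltl_sat Pi (Always p) <-> forall j, ltl_sat (shift Pi j) p.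
Proof.
rewrite Neg_sat Eventually_sat -forallNE; split=> H j; first exact: contrapT (H j).
by apply; exact: H.
Qed.

Variable a : AP.

Definition positions (t : trace AP) : pred nat := fun n => a \in t n.

(** [Next] leaves the current point of [x], at which the [Neg x] guarding the [Until] would fail. *)
Definition refinement_ltl : ltl AP :=
  let x := Atom a 0 in let y := Atom a 1 in
  And (Always (Eventually x))
      (Eventually (Always
        (Or (Neg x) (And y (Next (Until (Neg x) (And y (Neg x)))))))).

Definition refinement_sentence : hyperltl AP :=
  Forall 0 (Exists 1 (Matrix refinement_ltl)).

Lemma refinement_ltl_sat (s t : trace AP) :
  ltl_sat (update (update (@empty_assignment AP) 0 s) 1 t) refinement_ltl <->
  infinitely_often (positions s) /\
  eventually_refined (positions s) (positions t).
Proof.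
set Pi := update _ _ _.
have x_sat n : ltl_sat (shift Pi n) (Atom a 0) <-> positions s n.
  split=> [[_ [<-]]|sn]; first by rewrite /Defs.suffix addn0.
  by exists (Defs.suffix s n) => //; rewrite /Defs.suffix addn0.
have y_sat n : ltl_sat (shift Pi n) (Atom a 1) <-> positions t n.
  split=> [[_ [<-]]|tn]; first by rewrite /Defs.suffix addn0.
  by exists (Defs.suffix t n) => //; rewrite /Defs.suffix addn0.
have step_sat n : ltl_sat (shift Pi n)
    (Or (Neg (Atom a 0)) (And (Atom a 1)
       (Next (Until (Neg (Atom a 0)) (And (Atom a 1) (Neg (Atom a 0))))))) <->
    refined_at (positions s) (positions t) n.
  split.
    move=> /Or_sat[/Neg_sat nxn /x_sat//|].
    move=> /And_sat[/y_sat tn /Next_sat/Until_sat[j]] + xU _.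
    rewrite !shift_shift => /And_sat[/y_sat tj /Neg_sat nxj]; split=> //.
    exists (n + (1 + j)); first lia.
    split=> //.
      by apply/negP => sj; apply/nxj/x_sat.
    move=> i lt_i; have := xU (i - n.+1).
    rewrite !shift_shift addnA addn1 subnKC; last lia.
    by move=> /(_ ltac:(lia))/Neg_sat nsi; apply/negP => si; apply/nsi/x_sat.
  move=> st; have [sn|nsn] := boolP (positions s n); last first.
    by apply/Or_sat; left; apply/Neg_sat => /x_sat; exact/negP.
  apply/Or_sat; right; apply/And_sat; have [tn [j lt_nj [tj sj no_s]]] := st sn.
  split; first exact/y_sat.
  apply/Next_sat/Until_sat.
  exists (j - n.+1) => [|i lt_i]; rewrite !shift_shift addnA addn1.
    rewrite subnKC //; apply/And_sat; split; first exact/y_sat.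
    by apply/Neg_sat => /x_sat; exact/negP.
  by apply/Neg_sat => /x_sat; apply/negP/no_s; lia.
split.
  move=> /And_sat[/Always_sat s_inf /Eventually_sat[N /Always_sat st]]; split.
    move=> M; have /Eventually_sat[j] := s_inf M.
    by rewrite shift_shift => /x_sat sj; exists (M + j); first exact: leq_addr.
  exists N => n le_n; apply/step_sat; have := st (n - N).
  by rewrite shift_shift subnKC.
move=> [s_inf [N st]]; apply/And_sat; split.
  apply/Always_sat => M; apply/Eventually_sat; have [n le_n sn] := s_inf M.
  by exists (n - M); rewrite shift_shift subnKC //; apply/x_sat.
apply/Eventually_sat; exists N; apply/Always_sat => n.
by rewrite shift_shift; apply/step_sat/st/leq_addr.
Qed.

Lemma models_refinement (T : set (trace AP)) :
  models T refinement_sentence <->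
  forall s, T s -> infinitely_often (positions s) /\
    exists2 t, T t & eventually_refined (positions s) (positions t).
Proof.
split=> TP s Ts.
  have [t Tt /refinement_ltl_sat[s_inf st]] := TP s Ts.
  by split=> //; exists t.
have [s_inf [t Tt st]] := TP s Ts.
by exists t => //; apply/refinement_ltl_sat.
Qed.

Definition float_trace (k : nat) : trace AP :=
  fun n => if float k.+1 n then [set a]%SET else finset.set0.

Lemma positions_float_trace (k : nat) :
  positions (float_trace k) = float k.+1.
Proof.
apply/funext => n; rewrite /positions /float_trace.
by case: ifP => _; rewrite inE // eqxx.
Qed.

Lemma refinement_satisfiable : satisfiable refinement_sentence.
Proof.
exists (range float_trace); first by exists (float_trace 0), 0.
apply/models_refinement => _ [k _ <-]; rewrite positions_float_trace.
split; first exact: float_infinite.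
exists (float_trace k.+1); first by exists k.+1.
by rewrite positions_float_trace; exact: float_refined.
Qed.

(** Descent on [g] for all traces of [T] at once, since each step passes from [t] to its
    refinement. *)
Lemma refinement_gaps_unbounded (T : set (trace AP)) (g : nat) (t : trace AP) :
  models T refinement_sentence -> T t -> ~ gaps_bounded g (positions t).
Proof.
move=> /models_refinement TP; elim: g t => [|g IHg] t Tt.
  by move=> [N /(_ N (leqnn N))[]].
have [_ [u Tu tu]] := TP t Tt.
by move=> /(gaps_bounded_refined tu); exact: IHg.
Qed.

End Formula.

Theorem theorem6 (AP : finType) (AP_nonempty : (0 < #|AP|)%N) :
  exists phi : hyperltl AP,
    [/\ sentence phi,
        satisfiable phi &
        forall T : set (trace AP),
          (exists2 t : trace AP, T t & ultimately_periodic t) ->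
          ~ models T phi].
Proof.
have /card_gt0P[a _] := AP_nonempty.
exists (refinement_sentence a); split=> //.
  exact: refinement_satisfiable.
move=> T [t Tt /ultimately_periodicP[s [p [_ p_gt0 tP]]]] TP.
(* Infinitude is essential here: an ultimately periodic trace may eventually lack [a], and then its
   gaps are not bounded. *)
have [t_inf _] := (models_refinement a T).1 TP t Tt.
apply: (refinement_gaps_unbounded a T p t TP Tt).
apply: (gaps_bounded_periodic (s := s) p_gt0 _ t_inf) => n le_n.
by rewrite /positions (tP _ le_n).
Qed.
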